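(* Let $q$ be such that $\pm q$ is a PV number (i.e. $q$ or $-q$ is a PV number). Let $m \geq 1$ and $M \geq 0$ be integers, and let $\alpha_1, \ldots, \alpha_m$ be non-zero algebraic integers in $\mathbb{Q}(q)$ satisfying $$\max\{|\alpha_1|, |\alpha_2|, \ldots, |\alpha_m|\} \, \prod_{l=2}^{n_q} \max\{1, |\sigma_l(\alpha_1)|, |\sigma_l(\alpha_2)|, \ldots, |\sigma_l(\alpha_m)|\} < |q|.$$ Suppose that $\alpha_{k_1}/\alpha_{k_2}$ is not a root of unity for $1 \leq k_1, k_2 \leq m$ with $k_1 \neq k_2$. Then the numbers in the set $$S := \{ E_q^{(j)}(\alpha_k) : 1 \leq k \leq m, \ 0 \leq j \leq M \} \cup \{1\}$$ are linearly independent over the field $\mathbb{Q}(q)$.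
   Context: A real algebraic integer $\omega$ is called a Pisot–Vijayraghavan number (PV number) if $\omega > 1$ and all other Galois conjugates $\omega^{(j)}$ of $\omega$ satisfy $|\omega^{(j)}| < 1$ (in particular, integers greater than $1$ are PV numbers). For an algebraic integer $q \neq 0$, $n_q = [\mathbb{Q}(q):\mathbb{Q}]$, and $\sigma_1, \ldots, \sigma_{n_q}$ denote the embeddings of $\mathbb{Q}(q)$ into $\mathbb{C}$, with $\sigma_1$ the identity. Here $|\cdot|$ is the usual complex absolute value. For $q$ with $|q| > 1$, the $q$-exponential function is $$E_q(x) = 1 + \sum_{n=1}^{\infty} \frac{x^n}{[n]_q!}, \qquad [n]_q = q^n - 1, \quad [n]_q! = (q^n-1)(q^{n-1}-1)\cdots(q-1).$$ (Note that $[n]_q$ is $q^n-1$, without division by $q-1$.) $E_q^{(j)}$ denotes its $j$-th derivative with respect to $x$ (with $E_q^{(0)} = E_q$). *)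

(* Defs.v *)
From HB Require Import structures.
From mathcomp Require Import all_boot all_order all_algebra.
From mathcomp Require Import complex.
From mathcomp Require Import all_classical all_reals all_analysis.
Set Implicit Arguments.
Unset Strict Implicit.
Unset Printing Implicit Defensive.
Import Order.TTheory GRing.Theory Num.Theory.
Import numFieldNormedType.Exports.
Import ComplexField.Normc.
Local Open Scope complex_scope.
Local Open Scope classical_set_scope.
Local Open Scope ring_scope.

(* Everything is stated inside the real numbers: a PV number q is real, hence
   Q(q) is a subfield of R.  Complex numbers R[i] only occur as Galois
   conjugates and as targets of the embeddings of Q(q); [normc : R[i] -> R] is
   the usual absolute value. *)

Definition algebraic_integer (R : realType) (x : R) : Prop :=
  integralOver (intr : int -> R) x.

Definition is_minpoly_rat (R : realType) (x : R) (p : {poly rat}) : Prop :=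
  [/\ p \is monic, irreducible_poly p & root (map_poly ratr p) x].

Definition galois_conjugate (R : realType) (x : R) (z : R[i]) : Prop :=
  exists2 p : {poly rat}, is_minpoly_rat x p & root (map_poly ratr p) z.

Definition PV_number (R : realType) (w : R) : Prop :=
  [/\ algebraic_integer w, 1 < w
    & forall z : R[i], galois_conjugate w z -> z != w%:C -> normc z < 1].

Definition adjoin_rat (R : realType) (q : R) : {pred R} := fun x =>
  `[< exists p r : {poly rat}, (map_poly ratr r).[q] != 0 /\
        x = (map_poly ratr p).[q] / (map_poly ratr r).[q] >].

Lemma adjoin_rat_divring (R : realType) (q : R) : divring_closed (adjoin_rat q).
Proof.
split.
- apply/asboolP; exists 1, 1.
  by rewrite rmorph1 hornerE oner_neq0 divr1.
- move=> x y /asboolP[p [r [r0 ->]]] /asboolP[p' [r' [r'0 ->]]].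
  apply/asboolP; exists (p * r' - p' * r), (r * r').
  rewrite rmorphB !rmorphM /= !hornerE mulf_neq0 //; split=> //.
  by rewrite -mulNr addf_div // mulNr.
- move=> x y /asboolP[p [r [r0 ->]]] /asboolP[p' [r' [r'0 ->]]].
  apply/asboolP; have [p'0|p'0] := eqVneq (map_poly ratr p').[q] 0.
    exists 0, 1; rewrite rmorph0 rmorph1 !hornerE oner_neq0; split=> //.
    by rewrite p'0 !(mul0r, invr0, mulr0).
  exists (p * r'), (r * p'); rewrite !rmorphM /= !hornerE mulf_neq0 //.
  by split=> //; rewrite invf_div mulf_div.
Qed.

HB.instance Definition _ (R : realType) (q : R) :=
  GRing.isDivringClosed.Build R (adjoin_rat q) (adjoin_rat_divring q).

(* The field Q(q), as a subfield of R. *)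
Record Qadjoin (R : realType) (q : R) :=
  InQadjoin { Qval :> R; _ : Qval \in adjoin_rat q }.

HB.instance Definition _ (R : realType) (q : R) :=
  [isSub for @Qval R q].
HB.instance Definition _ (R : realType) (q : R) :=
  [Choice of Qadjoin q by <:].
HB.instance Definition _ (R : realType) (q : R) :=
  [SubChoice_isSubIntegralDomain of Qadjoin q by <:].
HB.instance Definition _ (R : realType) (q : R) :=
  [SubIntegralDomain_isSubField of Qadjoin q by <:].

(* [Q(q) : Q] = n, i.e. Q(q) has a basis of n elements over Q. *)
Definition Qadjoin_degree (R : realType) (q : R) (n : nat) : Prop :=
  exists b : 'I_n -> Qadjoin q, forall x : Qadjoin q,
    exists! c : {ffun 'I_n -> rat}, x = \sum_(i < n) ratr (c i) * b i.

(* [sigma] lists all the embeddings of Q(q) into C, without repetition, the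
   first one being the inclusion.  A ring morphism between fields is
   automatically injective. *)
Definition lists_embeddings (R : realType) (q : R) (n : nat)
    (sigma : 'I_n.+1 -> {rmorphism Qadjoin q -> R[i]}) : Prop :=
  [/\ forall x : Qadjoin q, sigma ord0 x = (x : R)%:C,
      forall i j, sigma i =1 sigma j -> i = j
    & forall tau : {rmorphism Qadjoin q -> R[i]}, exists i, tau =1 sigma i].

Definition qfact (R : realType) (q : R) (n : nat) : R :=
  \prod_(1 <= i < n.+1) (q ^+ i - 1).

Definition qexp (R : realType) (q x : R) : R :=
  1 + limn (fun N => \sum_(1 <= n < N) x ^+ n / qfact q n).

(* The elements of the set S, indexed by the pairs (k, j) for the values
   E_q^(j)(alpha_k) and by [None] for the number 1. *)
Definition qexp_values (R : realType) (q : R) (m M : nat)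
    (alpha : 'I_m -> Qadjoin q) (i : option ('I_m * 'I_M.+1)) : R :=
  if i is Some (k, j) then derive1n j (qexp q) (alpha k : R) else 1.

Definition Qadjoin_lin_indep (R : realType) (q : R) (I : finType)
    (v : I -> R) : Prop :=
  forall c : I -> Qadjoin q,
    \sum_(i : I) (c i : R) * v i = 0 -> forall i, c i = 0.

(* Main.v *)
Require Import Defs.
From mathcomp Require Import all_boot all_order all_algebra.
From mathcomp Require Import algC algnum zify ring lra.
From mathcomp Require Import complex.
From mathcomp Require Import all_classical all_reals all_analysis.
Set Implicit Arguments.
Unset Strict Implicit.
Unset Printing Implicit Defensive.
Import Order.TTheory GRing.Theory Num.Theory.
Import numFieldNormedType.Exports.
Import ComplexField.Normc.
Local Open Scope ring_scope.

(** Let K = Q(q) and suppose that a K-linear combination of 1 and of the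
    numbers E_q^(j)(alpha_k) vanishes; after multiplication by an element of K
    its coefficients c_0 and c_(k,j) are algebraic integers
    ([family_integral_denominator]).  Differentiating the power series term by
    term ([cvg_derive1n_qexp]) turns the relation into

      c_0 + sum_n u_n / [n]_q! = 0,
      u_n = sum_(k,j) c_(k,j) (X^n)^(j)(alpha_k),

    and the idea is to look at A_N, which is [N]_q! times the partial sum of
    order N.  It is an algebraic integer of K, given by A_0 = c_0 + u_0 and
    A_(N+1) = (q^(N+1) - 1) A_N + u_(N+1), and all its conjugates can be
    bounded, up to constants and up to a factor t^N with t > 1 as close to 1 as
    desired:

    - the whole series being 0, A_N is minus its tail, hence of size
      (max_k |alpha_k| / |q|)^N ([backward_decay]);
    - for an embedding sigma other than the inclusion, |sigma(q)| < 1 by the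
      Pisot condition, so the factors sigma(q)^N - 1 of the recurrence have a
      bounded product and sigma(A_N) grows no faster than the sum of the
      sigma(u_n), that is like max(1, |sigma(alpha_k)|)^N ([forward_growth]).

    The size hypothesis says exactly that the product of these rates is smaller
    than 1.  So the norm of A_N, a rational integer ([norm_integral_ge1]), tends
    to 0, which forces A_N = 0 and then u_N = 0 for all large N.

    Finally u_n = Lambda(X^n) for the linear form
    Lambda(f) = sum_(k,j) c_(k,j) f^(j)(alpha_k) on polynomials.  A form of
    this kind that kills all multiples of X^N is zero, as one sees by testing it
    on polynomials vanishing to prescribed orders at the alpha_k
    ([confluent_Vandermonde]); this uses that the alpha_k are distinct and
    nonzero.  Hence all the c_(k,j) vanish, and then c_0 as well. *)

Local Notation Zintegral x := (integralOver (intr : int -> _) x).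

(** * Norms and algebraic integers *)

(** Dedekind's argument: from a relation with two nonzero coefficients c_i and
    c_j and a point y where sigma_i and sigma_j differ, subtracting sigma_i(y)
    times the relation from the relation at y x gives a shorter one. *)
Lemma embeddings_independent (K L : fieldType) (n : nat)
    (sigma : 'I_n -> {rmorphism K -> L})
    (sigma_inj : forall i j, sigma i =1 sigma j -> i = j) (c : 'I_n -> L) :
  (forall x, \sum_i c i * sigma i x = 0) -> forall i, c i = 0.
Proof.
have [N] := ubnP #|[set i | c i != 0]|.
elim: N c => // N IHN c ltN sum0 i; apply/eqP/negP => /negP ci0.
(* A second nonzero coefficient would allow the relation to be shortened. *)
have others0 j : j != i -> c j = 0.
  move=> neq_ji; have [y neq_y] : exists y, sigma i y != sigma j y.
    apply: contrapT => /forallNP eq_s; case/eqP: neq_ji.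
    apply/esym/sigma_inj => y.
    by case: eqP (eq_s y) => // _ /(_ isT).
  pose c' k := c k * (sigma k y - sigma i y).
  suff : c' j = 0.
    move/eqP; rewrite mulf_eq0 subr_eq0 [_ == sigma i y]eq_sym (negPf neq_y).
    by rewrite orbF => /eqP.
  apply: IHN => [|x].
    rewrite -ltnS; apply: leq_trans ltN; rewrite ltnS; apply: proper_card.
    apply/properP; split.
      by apply/fintype.subsetP => k; rewrite !inE mulf_eq0 negb_or => /andP[].
    by exists i; rewrite !inE // /c' subrr mulr0 eqxx.
  transitivity (\sum_k c k * sigma k (y * x)
                - sigma i y * \sum_k c k * sigma k x).
    rewrite mulr_sumr -sumrB; apply: eq_bigr => k _.
    by rewrite /c' rmorphM mulrBr mulrBl !mulrA (mulrC (sigma i y)).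
  by rewrite !sum0 mulr0 subrr.
case/eqP: ci0; have := sum0 1; rewrite (bigD1 i) //= rmorph1 mulr1.
by rewrite big1 ?addr0 // => j /others0->; rewrite mul0r.
Qed.

(** The result is known for algebraic integers inside the field of algebraic
    numbers, into which the rational numbers embed. *)
Lemma integral_rat_int (x : rat) :
  Zintegral x -> exists z : int, x = z%:~R.
Proof.
case=> p monp rootp.
have Aint_x : (ratr x : algC) \in Aint.
  apply: (@root_monic_Aint (map_poly ratr (map_poly intr p))).
  - by rewrite fmorph_root.
  - by do 2!apply: monic_map.
  - apply/polyOverP => i; rewrite !coef_map /= ratr_int.
    exact: intr_int.
have /intrP[z /eqP] : (ratr x : algC) \is a Num.int.
  by apply: Cint_rat_Aint Aint_x; apply: Crat_rat.
by rewrite -(ratr_int _ z) fmorph_eq => /eqP; exists z.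
Qed.

(** With as many embeddings as basis vectors, the matrix S of the values
    sigma_l(b_i) is square, and it is invertible because the embeddings are
    independent.  If A is the rational matrix of the multiplication by x, then
    A S = S diag(sigma_l(x)), so the product of the sigma_l(x) is det A. *)
Lemma prod_embeddings_rat (K : fieldType) (L : numFieldType) (n : nat)
    (b : 'I_n -> K)
    (b_span : forall x, exists c : {ffun 'I_n -> rat},
      x = \sum_i ratr (c i) * b i)
    (sigma : 'I_n -> {rmorphism K -> L})
    (sigma_inj : forall i j, sigma i =1 sigma j -> i = j) (x : K) :
  exists r : rat, \prod_i sigma i x = ratr r.
Proof.
have /choice[M defM] i := b_span (x * b i).
pose A : 'M[rat]_n := \matrix_(i, j) M i j.
pose S : 'M[L]_n := \matrix_(i, l) sigma l (b i).
pose d : 'rV[L]_n := \row_l sigma l x.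
have detS : \det S != 0.
  rewrite -det_tr; apply/det0P => -[v v0 vS]; case/eqP: v0.
  apply/rowP => l; rewrite mxE.
  apply: (@embeddings_independent K L n sigma) => // y.
  have [c ->] := b_span y.
  transitivity (\sum_i ratr (c i) * (v *m S^T) 0 i).
    under eq_bigr do rewrite rmorph_sum mulr_sumr.
    rewrite exchange_big; apply: eq_bigr => i _; rewrite mxE mulr_sumr.
    apply: eq_bigr => j _; rewrite !mxE rmorphM fmorph_rat.
    by rewrite mulrCA.
  by rewrite vS; under eq_bigr do rewrite mxE mulr0; rewrite big1_eq.
have AS : map_mx ratr A *m S = S *m diag_mx d.
  apply/matrixP => i l; rewrite mul_mx_diag !mxE.
  rewrite mulrC -rmorphM defM rmorph_sum.
  by apply: eq_bigr => j _; rewrite !mxE rmorphM fmorph_rat.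
exists (\det A); rewrite -det_map_mx; apply: (mulIf detS).
rewrite -[RHS]det_mulmx AS det_mulmx det_diag mulrC; congr (_ * _).
by apply: eq_bigr => l _; rewrite mxE.
Qed.

Lemma fmorph_integral (K L : fieldType) (f : {rmorphism K -> L}) (x : K) :
  Zintegral x <-> Zintegral (f x).
Proof.
have eqp (p : {poly int}) : map_poly f (map_poly intr p) = map_poly intr p.
  by apply/polyP => i; rewrite !coef_map /= rmorph_int.
by split=> -[p monp rootp]; exists p => //;
  rewrite -(fmorph_root f) eqp in rootp *.
Qed.

(** A nonzero rational polynomial of least size vanishing at x: in a
    factorization of it, one of the two factors vanishes at x, hence has the
    same size. *)
Lemma minpoly_exists (R : realType) (x : R) :
  algebraic_integer x -> exists p, is_minpoly_rat x p.
Proof.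
case=> p0 monp0 rootp0.
pose P (k : nat) := `[< exists p : {poly rat},
  [/\ p != 0, root (map_poly ratr p) x & size p = k] >].
have exP : exists k, P k.
  exists (size (map_poly (intr : int -> rat) p0)); apply/asboolP.
  exists (map_poly intr p0); split=> //.
    exact/monic_neq0/monic_map.
  suff -> : map_poly ratr (map_poly intr p0) =
      map_poly (intr : int -> R) p0 by [].
  by apply/polyP => i; rewrite !coef_map /= ratr_int.
case: (ex_minnP exP) => k /asboolP[p [p0' rootp szp]] mink.
have {mink}minp (d : {poly rat}) : d != 0 -> root (map_poly ratr d) x ->
    (size p <= size d)%N.
  by move=> d0 rootd; rewrite szp; apply: mink; apply/asboolP; exists d.
have lc0 : lead_coef p != 0 by rewrite lead_coef_eq0.
exists ((lead_coef p)^-1 *: p); split.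
- by rewrite monicE lead_coefZ mulVf.
- split=> [|d szd].
    rewrite size_scale ?invr_eq0 // ltnNge; apply/negP => /size1_polyC eq_p.
    move: rootp p0'; rewrite eq_p map_polyC /= rootE hornerC fmorph_eq0.
    by rewrite polyC_eq0 => ->.
  rewrite dvdpZr ?invr_eq0 // => dvd_dp.
  rewrite (eqp_trans _ (_ : p %= _)) //; last first.
    by rewrite eqp_sym eqp_scale ?invr_eq0.
  have /dvdpP[e def_p] := dvd_dp.
  have [e0 d0] : e != 0 /\ d != 0.
    by apply/andP; rewrite -negb_or -mulf_eq0 -def_p.
  move: rootp; rewrite def_p rmorphM rootM => /orP[] /minp => [/(_ e0)|/(_ d0)].
    rewrite def_p size_mul // -subn1 leq_subLR addnC leq_add2r.
    move: szd; rewrite -size_poly_gt0 in d0.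
    by case: (size d) d0 => [|[|?]].
  by rewrite -def_p -dvdp_size_eqp // eqn_leq dvdp_leq.
- by rewrite map_polyZ rootZ // fmorph_eq0 invr_eq0.
Qed.

(** * The field Q(q) and its embeddings *)

Definition Qinj (R : realType) (q : R) : {rmorphism Qadjoin q -> R} := val.

Lemma adjoin_rat_gen (R : realType) (q : R) : q \in adjoin_rat q.
Proof.
apply/asboolP; exists 'X, 1.
by rewrite map_polyX rmorph1 !hornerE oner_neq0 divr1.
Qed.

Definition Qgen (R : realType) (q : R) : Qadjoin q :=
  InQadjoin (adjoin_rat_gen q).

(** The value of p at x, computed inside Q(q): [ratr] is known to be a ring
    morphism only towards a [numFieldType], so it cannot be mapped over p
    here. *)
Definition Qhorner (R : realType) (q : R) (p : {poly rat}) (x : Qadjoin q) :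
    Qadjoin q :=
  \sum_(i < size p) ratr p`_i * x ^+ i.

Lemma rmorph_Qhorner (R : realType) (q : R) (L : numFieldType)
    (f : {rmorphism Qadjoin q -> L}) (p : {poly rat}) (x : Qadjoin q) :
  f (Qhorner p x) = (map_poly ratr p).[f x].
Proof.
rewrite horner_coef size_map_poly rmorph_sum; apply: eq_bigr => i _.
by rewrite coef_map rmorphM rmorphXn fmorph_rat.
Qed.

Lemma Qadjoin_fraction (R : realType) (q : R) (x : Qadjoin q) :
  exists2 p : {poly rat} * {poly rat}, Qhorner p.2 (Qgen q) != 0
    & x * Qhorner p.2 (Qgen q) = Qhorner p.1 (Qgen q).
Proof.
have /asboolP[p [r [r0 def_x]]] := valP x.
exists (p, r) => /=; first by rewrite -(fmorph_eq0 (Qinj q)) rmorph_Qhorner.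
apply: (fmorph_inj (Qinj q)); rewrite rmorphM !rmorph_Qhorner /=.
by rewrite [Qval x]def_x divfK.
Qed.

Lemma eq_rmorph_Qadjoin (R : realType) (q : R) (L : numFieldType)
    (f g : {rmorphism Qadjoin q -> L}) :
  f (Qgen q) = g (Qgen q) -> f =1 g.
Proof.
move=> eq_fg x; have [[p r] /= r0 xr] := Qadjoin_fraction x.
have r0' : f (Qhorner r (Qgen q)) != 0 by rewrite fmorph_eq0.
have eqH s : f (Qhorner s (Qgen q)) = g (Qhorner s (Qgen q)).
  by rewrite !rmorph_Qhorner eq_fg.
by apply: (mulIf r0'); rewrite -rmorphM xr !eqH -xr rmorphM.
Qed.

Lemma Qhorner_integral (R : realType) (q : R) (p : {poly rat}) :
  algebraic_integer q ->
  exists2 d : int, d != 0 &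
    Zintegral (d%:~R * Qhorner p (Qgen q)).
Proof.
move=> intq; have [r [d d0 def_p]] := rat_poly_scale p; exists d => //.
apply/(fmorph_integral (Qinj q)); rewrite rmorphM rmorph_int rmorph_Qhorner.
have -> : d%:~R * (map_poly ratr p).[Qinj q (Qgen q)] =
    (map_poly (intr : int -> R) r).[q].
  rewrite def_p map_polyZ hornerZ fmorphV rmorph_int mulVKf ?intr_eq0 //.
  by congr (_.[_]); apply/polyP => i; rewrite !coef_map /= ratr_int.
apply: integral_horner => //; apply/integral_poly => i.
by rewrite coef_map; apply: integral_id.
Qed.

(** Writing x = p(q) / r(q), a multiple of r(q) by an integer clearing the
    denominators of the coefficients does it. *)
Lemma integral_denominator (R : realType) (q : R) (x : Qadjoin q) :
  algebraic_integer q ->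
  exists2 d : Qadjoin q, d != 0 & Zintegral d /\ Zintegral (d * x).
Proof.
move=> intq; have [[p r] /= r0 xr] := Qadjoin_fraction x.
have [d d0 intd] := Qhorner_integral p intq.
have [e e0 inte] := Qhorner_integral r intq.
have int0 (z : int) : z != 0 -> z%:~R != 0 :> Qadjoin q.
  by move=> z0; rewrite -(fmorph_eq0 (Qinj q)) rmorph_int intr_eq0.
exists (d%:~R * (e%:~R * Qhorner r (Qgen q)));
  first by rewrite !mulf_neq0 ?int0.
split; first by apply: integral_mul => //; apply: integral_id.
have -> : d%:~R * (e%:~R * Qhorner r (Qgen q)) * x =
    e%:~R * (d%:~R * Qhorner p (Qgen q)).
  by rewrite -xr; ring.
by apply: integral_mul => //; apply: integral_id.
Qed.

Lemma family_integral_denominator (R : realType) (q : R) (I : finType)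
    (c : I -> Qadjoin q) :
  algebraic_integer q ->
  exists2 d : Qadjoin q, d != 0 & forall i, Zintegral (d * c i).
Proof.
move=> intq.
have /choice[d dP] i : exists d : Qadjoin q,
    [/\ d != 0, Zintegral d & Zintegral (d * c i)].
  by have [d ? []] := integral_denominator (c i) intq; exists d.
exists (\prod_i d i) => [|i]; first by apply/prodf_neq0 => i _; have [] := dP i.
rewrite (bigD1 i) //= mulrAC mulrC; apply: integral_mul;
  last by have [] := dP i.
apply: big_ind => [||j _]; [exact: integral1 | exact: integral_mul | ].
by have [] := dP j.
Qed.

Lemma normc_intr_ge1 (R : rcfType) (z : int) :
  z != 0 -> 1 <= normc (z%:~R : R[i]).
Proof.
move=> z0; have : 1 <= `|z%:~R : R[i]|.
  by rewrite -intr_norm ler1z -gtz0_ge1 normr_gt0.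
by rewrite -[`|_|]/((normc (z%:~R : R[i]))%:C%C) -(lecR 1).
Qed.

(** The product of the conjugates of x is rational and an algebraic integer,
    hence a rational integer, and it is nonzero. *)
Lemma norm_integral_ge1 (R : realType) (q : R) (n : nat)
    (hn : Qadjoin_degree q n)
    (sigma : 'I_n -> {rmorphism Qadjoin q -> R[i]})
    (sigma_inj : forall i j, sigma i =1 sigma j -> i = j)
    (x : Qadjoin q) :
  Zintegral x -> x != 0 ->
  1 <= \prod_i normc (sigma i x).
Proof.
move=> intx x0; have [b bP] := hn.
have b_span y : exists c : {ffun 'I_n -> rat}, y = \sum_i ratr (c i) * b i.
  by have [c [? _]] := bP y; exists c.
have [r def_r] := prod_embeddings_rat b_span sigma_inj x.
have [z def_z] : exists z : int, r = z%:~R.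
  apply/integral_rat_int/(fmorph_integral (ratr : {rmorphism rat -> R[i]})).
  rewrite -[X in integralOver _ X]def_r.
  apply: big_ind => [||j _]; [exact: integral1 | exact: integral_mul | ].
  exact: (proj1 (fmorph_integral (sigma j) x)).
have -> : \prod_i normc (sigma i x) = normc (z%:~R : R[i]).
  rewrite -(ratr_int _ z) -def_z -def_r.
  by elim/big_rec2: _ => [|i y1 y2 _ ->]; rewrite ?normc1 // normcM.
apply: normc_intr_ge1; apply/eqP => z0; move: def_r; rewrite def_z z0 rmorph0.
by apply/eqP/prodf_neq0 => i _; rewrite fmorph_eq0.
Qed.

(** The image of q under another embedding is a root of the minimal polynomial
    of q, and it is not q itself because q generates the field. *)
Lemma PV_embedding_lt1 (R : realType) (q : R) (n : nat)
    (sigma : 'I_n.+1 -> {rmorphism Qadjoin q -> R[i]})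
    (hsigma : lists_embeddings sigma) (l : 'I_n.+1) :
  PV_number q \/ PV_number (- q) -> l != ord0 -> normc (sigma l (Qgen q)) < 1.
Proof.
have [sigma0 sigma_inj _] := hsigma.
move=> hq l0; have neq_gen : sigma l (Qgen q) != sigma ord0 (Qgen q).
  apply: contra l0 => /eqP/eq_rmorph_Qadjoin eq_l.
  by apply/eqP/sigma_inj.
have conj_bound (x : Qadjoin q) :
    PV_number (x : R) -> sigma l x != (x : R)%:C%C -> normc (sigma l x) < 1.
  case=> intx _ bound neq_x; apply: bound neq_x.
  have [p minp] := minpoly_exists intx; exists p => //.
  have [_ _ rootp] := minp.
  rewrite rootE -rmorph_Qhorner fmorph_eq0 -(fmorph_eq0 (Qinj q)).
  by rewrite rmorph_Qhorner.
case: hq => hq; first by apply: conj_bound; rewrite -?sigma0.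
rewrite -normcN -[- _](rmorphN (sigma l)); apply: conj_bound => //.
by rewrite rmorphN -sigma0 rmorphN eqr_opp.
Qed.

(** * Linear recurrences that vanish from some rank on *)

Lemma derivn_XsubC_exp_mul (F : comNzRingType) (a : F) (d : nat)
    (g : {poly F}) :
  (forall j, (j < d)%N -> ((('X - a%:P) ^+ d * g)^`(j)).[a] = 0) /\
  ((('X - a%:P) ^+ d * g)^`(d)).[a] = d`!%:R * g.[a].
Proof.
elim: d g => [|d IHd] g; first by split=> //; rewrite expr0 !mul1r derivn0.
have deriv_step : (('X - a%:P) ^+ d.+1 * g)^`() =
    ('X - a%:P) ^+ d * (d.+1%:R *: g + ('X - a%:P) * g^`()).
  rewrite derivM deriv_exp derivXsubC mul1r exprS -mul_polyC polyC_natr /=.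
  by rewrite -mulr_natr; ring.
have [vanish top] := IHd (d.+1%:R *: g + ('X - a%:P) * g^`()).
split=> [[|j] ltjd|].
- by rewrite derivn0 hornerM exprS hornerM !hornerE subrr !mul0r.
- by rewrite derivSn deriv_step vanish.
- rewrite derivSn deriv_step top !hornerE subrr mul0r addr0.
  by rewrite mulrA -natrM mulnC -factS.
Qed.

(** Let Lambda(f) be the sum of the c_(k,j) f^(j)(alpha_k); it kills every
    multiple of X^N.  If j is the largest index with c_(k,j) nonzero, test
    Lambda on a multiple of X^N that vanishes to order exactly j at alpha_k and
    to order at least M at the other points: only c_(k,j) contributes. *)
Lemma confluent_Vandermonde (F : numFieldType) (m M : nat) (alpha : 'I_m -> F)
    (alpha_inj : injective alpha) (alpha0 : forall k, alpha k != 0)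
    (c : 'I_m -> 'I_M -> F) (N : nat) :
  (forall n, (N <= n)%N ->
     \sum_k \sum_j c k j * (('X^n)^`(j)).[alpha k] = 0) ->
  forall k j, c k j = 0.
Proof.
move=> sum0; pose Lambda (f : {poly F}) :=
  \sum_k \sum_j c k j * (f^`(j)).[alpha k].
have LambdaXN (f : {poly F}) : Lambda (f * 'X^N) = 0.
  transitivity (\sum_(i < size f) f`_i * Lambda 'X^(i + N)); last first.
    by rewrite big1 // => i _; rewrite /Lambda sum0 ?mulr0 // leq_addl.
  under [RHS]eq_bigr do rewrite /Lambda mulr_sumr.
  rewrite [RHS]exchange_big; apply: eq_bigr => k _.
  under [RHS]eq_bigr do rewrite mulr_sumr.
  rewrite [RHS]exchange_big; apply: eq_bigr => j _ /=.
  rewrite -{1}[f]coefK poly_def mulr_suml linear_sum horner_sum mulr_sumr.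
  apply: eq_bigr => i _.
  by rewrite -scalerAl -exprD linearZ hornerZ mulrCA.
move=> k; suff nz_max (j : 'I_M) :
    (forall i : 'I_M, (j < i)%N -> c k i = 0) -> c k j = 0.
  move=> j; have [d] := ubnP (M - j); elim: d j => // d IHd j ltd.
  apply: nz_max => i ltji; apply: IHd. 
  have := ltn_ord i; have := ltn_ord j; lia.
move=> above0.
pose g := \prod_(k' | k' != k) ('X - (alpha k')%:P) ^+ M * 'X^N.
have gk : g.[alpha k] != 0.
  rewrite hornerM hornerXn mulf_neq0 ?expf_neq0 //.
  rewrite horner_prod; apply/prodf_neq0 => k' neq_k.
  rewrite horner_exp hornerXsubC expf_neq0 // subr_eq0 (inj_eq alpha_inj).
  by rewrite eq_sym.
(* Of all the terms of Lambda, only the one with coefficient c k j survives on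
   the multiple of X^N below: the others have too few derivatives, or a zero
   coefficient. *)
have := LambdaXN (('X - (alpha k)%:P) ^+ j *
                  \prod_(k' | k' != k) ('X - (alpha k')%:P) ^+ M).
rewrite -mulrA -/g /Lambda (bigD1 k) //= [X in _ + X]big1 ?addr0; last first.
  move=> k' neq_k; rewrite big1 // => i _.
  pose h := \prod_(k'' | (k'' != k) && (k'' != k')) ('X - (alpha k'')%:P) ^+ M
            * 'X^N.
  have -> : ('X - (alpha k)%:P) ^+ j * g = ('X - (alpha k')%:P) ^+ M *
     (('X - (alpha k)%:P) ^+ j * h).
    by rewrite /g /h (bigD1 k') //= !mulrA; congr (_ * _ * _); rewrite mulrC.
  have [vanish _] := derivn_XsubC_exp_mul (alpha k') M
     (('X - (alpha k)%:P) ^+ j * h).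
  by rewrite vanish ?mulr0.
have [vanish top] := derivn_XsubC_exp_mul (alpha k) j g.
rewrite (bigD1 j) //= big1 ?addr0 => [|i neq_ij].
  rewrite top => /eqP; rewrite !mulf_eq0 (negPf gk) pnatr_eq0.
  by rewrite gtn_eqF ?fact_gt0 // !orbF => /eqP.
have [ltij|ltji|eq_ij] := ltngtP i j.
- by rewrite vanish ?mulr0.
- by rewrite above0 ?mul0r.
- by case/eqP: neq_ij; apply: val_inj.
Qed.

(** * Termwise differentiation of everywhere convergent power series *)

(** Coefficients of a power series converging everywhere, in the form of
    Cauchy's estimates, which are easily seen to pass to the derivative. *)
Definition entire_coef (R : realType) (f : nat -> R) : Prop :=
  forall rho : R, 0 < rho -> exists C, forall n, `|f n| * rho ^+ n <= C.

Lemma entire_pseries_diffs (R : realType) (f : nat -> R) :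
  entire_coef f -> entire_coef (pseries_diffs f).
Proof.
move=> ent rho rho0; have rho20 : 0 < 2 * rho by rewrite mulr_gt0.
have [C leC] := ent _ rho20; exists (C / rho) => n.
rewrite ler_pdivlMr //; apply: le_trans (leC n.+1).
rewrite /pseries_diffs normrM normr_nat exprMn -!mulrA -exprSr.
rewrite mulrCA ler_wpM2l // ler_wpM2r ?exprn_ge0 ?ltW //.
by rewrite -natrX ltr_nat // ltn_expl.
Qed.

Lemma entire_cvg_pseries (R : realType) (f : nat -> R) (x : R) :
  entire_coef f -> cvgn (pseries f x).
Proof.
move=> ent; pose rho := 2 * `|x| + 1.
have rho0 : 0 < rho by rewrite ltr_wpDl // mulr_ge0.
have [C leC] := ent _ rho0.
apply: normed_cvg.
apply: (@series_le_cvg _ _ (geometric C 2^-1)) => [n|n|n|].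
- exact: normr_ge0.
- rewrite /geometric /= mulr_ge0 ?exprn_ge0 ?invr_ge0 //.
  by apply: le_trans (leC 0%N); rewrite mulr_ge0 // exprn_ge0 // ltW.
- rewrite /= normrM normrX.
  apply: (@le_trans _ _ (`|f n| * rho ^+ n * 2^-1 ^+ n)).
    rewrite -mulrA ler_wpM2l // -exprMn lerXn2r ?nnegrE //.
      by rewrite mulr_ge0 ?invr_ge0 // ltW.
    by rewrite /rho; lra.
  by rewrite ler_wpM2r ?exprn_ge0 ?invr_ge0.
- apply: is_cvg_geometric_series.
  by rewrite ger0_norm ?invr_ge0 // invf_lt1 // ltr1n.
Qed.

Lemma derive1n_pseries (R : realType) (f : nat -> R) (j : nat) :
  entire_coef f ->
  derive1n j (fun x => limn (pseries f x)) =
  (fun x => limn (pseries (iter j (@pseries_diffs R) f) x)).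
Proof.
move=> ent; have entj i : entire_coef (iter i (@pseries_diffs R) f).
  by elim: i => // i; apply: entire_pseries_diffs.
elim: j => // j IHj; rewrite derive1nS IHj; apply/funext => x; rewrite derive1E.
(* Any radius beyond |x| would do. *)
have lt_x : `|x| < `| `|x| + 1|.
  by rewrite [X in _ < X]ger0_norm ?ltrDl // addr_ge0.
apply: (@derive_val _ _ _ _ _ _ _ (pseries_snd_diffs _ _ _ lt_x)).
- exact: entire_cvg_pseries.
- apply: entire_cvg_pseries; exact: (entj j.+1).
- apply: entire_cvg_pseries; exact: (entj j.+2).
Qed.

(** The j-th derivative of x^(n+j) is the falling factorial of n + j of length
    j, times x^n. *)
Lemma iter_pseries_diffs (R : realType) (f : nat -> R) (j n : nat) :
  iter j (@pseries_diffs R) f n = ((n + j) ^_ j)%:R * f (n + j)%N.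
Proof.
elim: j n => [|j IHj] n; first by rewrite addn0 ffactn0 mul1r.
rewrite iterS /pseries_diffs IHj addSnnS mulrA -natrM ffactnSr.
by rewrite addnS -addSn addnK mulnC.
Qed.

(** The j-th derivatives of the monomials X^n with n < j are zero, so the
    series may be indexed by the exponent before differentiation. *)
Lemma cvg_derive1n_pseries (R : realType) (f : nat -> R) (j : nat) (x : R) :
  entire_coef f ->
  (series (fun n => f n * (('X^n)^`(j)).[x]) @ \oo -->
   derive1n j (fun x => limn (pseries f x)) x)%classic.
Proof.
move=> ent; rewrite derive1n_pseries // -(cvg_shiftn j).
have entj : entire_coef (iter j (@pseries_diffs R) f).
  by elim: j => // j; apply: entire_pseries_diffs.
have := @entire_cvg_pseries _ _ x entj; apply: cvg_trans.
apply: near_eq_cvg; near=> N; rewrite /pseries /series /=.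
rewrite addnC [RHS](big_cat_nat (leq0n j)) ?leq_addr //=.
rewrite [X in _ = X + _]big_nat [X in _ = X + _]big1.
  rewrite add0r -{2}[j]add0n big_addn addKn; apply: eq_bigr => n _.
  rewrite iter_pseries_diffs derivnXn hornerMn hornerXn addnK.
  by rewrite -mulr_natl; ring.
move=> n /andP[_ ltnj].
by rewrite derivnXn ffact_small // mulr0n horner0 mulr0.
Unshelve. all: by end_near.
Qed.

(** * The q-exponential function *)

Lemma qfactS (R : realType) (q : R) (n : nat) :
  qfact q n.+1 = (q ^+ n.+1 - 1) * qfact q n.
Proof. by rewrite /qfact big_nat_recr //= mulrC. Qed.

(** The form |q|^n (|q| - 1) of the lower bound, rather than |q|^(n+1) - 1,
    makes the division by a power of |q| immediate. *)
Lemma normr_qint_ge (R : realType) (q : R) (n : nat) : 1 < `|q| ->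
  `|q| ^+ n * (`|q| - 1) <= `|q ^+ n.+1 - 1|.
Proof.
move=> q1; apply: le_trans (lerB_dist _ _); rewrite normrX normr1 exprSr.
have := exprn_ege1 n (ltW q1); rewrite mulrBr mulr1; lra.
Qed.

Lemma qint_neq0 (R : realType) (q : R) (n : nat) :
  1 < `|q| -> q ^+ n.+1 - 1 != 0.
Proof.
move=> q1; rewrite -normr_gt0; apply: lt_le_trans (normr_qint_ge n q1).
by rewrite mulr_gt0 ?subr_gt0 // exprn_gt0 // (lt_trans ltr01).
Qed.

Lemma qfact_neq0 (R : realType) (q : R) (n : nat) : 1 < `|q| -> qfact q n != 0.
Proof.
move=> q1; elim: n => [|n IHn]; first by rewrite /qfact big_geq ?oner_neq0.
by rewrite qfactS mulf_neq0 ?qint_neq0.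
Qed.

Lemma near_expr_le (R : realType) (s e : R) : `|s| < 1 -> 0 < e ->
  \forall n \near \oo%classic, s ^+ n <= e.
Proof.
move=> s1 e0; have := @cvg_geometric R 1 s s1; move/cvgrPdist_le/(_ e e0).
apply: filterS => n; rewrite sub0r normrN /geometric /= mul1r.
exact/le_trans/ler_norm.
Qed.

Lemma near_expr_ge (R : realType) (x B : R) : 1 < x ->
  \forall n \near \oo%classic, B <= x ^+ n.
Proof.
move=> x1; have x0 : 0 < x := lt_trans ltr01 x1.
have B0 : 0 < `|B| + 1 by rewrite ltr_wpDl.
have sx1 : `|x^-1| < 1 by rewrite ger0_norm ?invr_ge0 ?ltW // invf_lt1.
have := near_expr_le sx1 (_ : 0 < (`|B| + 1)^-1); rewrite invr_gt0 => /(_ B0).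
apply: filterS => n; rewrite exprVn lef_pV2 ?posrE ?exprn_gt0 //.
by apply: le_trans; apply: le_trans (ler_norm _) _; rewrite lerDl.
Qed.

(** The ratio of two consecutive terms rho^n / |[n]_q!| is
    rho / |q^(n+1) - 1|, at most 1 as soon as n is large. *)
Lemma entire_qfactV (R : realType) (q : R) : 1 < `|q| ->
  entire_coef (fun n => (qfact q n)^-1).
Proof.
move=> q1 rho rho0.
have q10 : 0 < `|q| - 1 by rewrite subr_gt0.
have [N _ leN] := near_expr_ge (rho / (`|q| - 1)) q1.
pose a n := `|(qfact q n)^-1| * rho ^+ n.
have aS n : (N <= n)%N -> a n.+1 <= a n.
  move=> leNn; rewrite /a qfactS invfM normrM [rho ^+ n.+1]exprS mulrACA.
  rewrite -[leRHS]mul1r ler_wpM2r //;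
    first by rewrite mulr_ge0 ?exprn_ge0 // ltW.
  rewrite normfV mulrC ler_pdivrMr ?normr_gt0 ?qint_neq0 // mul1r.
  apply: le_trans (normr_qint_ge n q1).
  by rewrite -ler_pdivrMr // leN.
have a0 n : 0 <= a n by rewrite mulr_ge0 ?exprn_ge0 // ltW.
(* The sum of the first terms is a convenient upper bound of their maximum. *)
exists (\sum_(i < N.+1) a i) => n; rewrite -/(a n).
elim: n => [|n IHn]; first by rewrite big_ord_recl lerDl sumr_ge0.
have [leNn|ltnN] := leqP N n; first exact: le_trans (aS _ leNn) IHn.
by rewrite (bigD1 (Ordinal (ltnN : n.+1 < N.+1)%N)) //= lerDl sumr_ge0.
Qed.

Lemma qexpE (R : realType) (q : R) : 1 < `|q| ->
  qexp q = (fun x => limn (pseries (fun n => (qfact q n)^-1) x)).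
Proof.
move=> q1; apply/funext => x; rewrite /qexp.
have cvgE := @entire_cvg_pseries _ _ x (entire_qfactV q1).
have qf0 : qfact q 0 = 1 by rewrite /qfact big_geq.
suff cvgT : ((fun N => \sum_(1 <= n < N) x ^+ n / qfact q n) @ \oo -->
    limn (pseries (fun n => (qfact q n)^-1) x) - 1)%classic.
  by rewrite (cvg_lim _ cvgT) //= addrC subrK.
apply: (@cvg_trans _
  ((pseries (fun n => (qfact q n)^-1) x \- cst 1) @ \oo)%classic); last first.
  by apply: cvgB => //; exact: cvg_cst.
apply: near_eq_cvg; near=> N; rewrite /pseries /series /=.
rewrite big_ltn; last by near: N; exact: nbhs_infty_gt.
rewrite expr0 qf0 invr1 mulr1 addrC addKr.
by apply: eq_bigr => n _; rewrite mulrC.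
Unshelve. all: by end_near.
Qed.

Lemma cvg_derive1n_qexp (R : realType) (q : R) (j : nat) (x : R) : 1 < `|q| ->
  (series (fun n => (('X^n)^`(j)).[x] / qfact q n) @ \oo -->
   derive1n j (qexp q) x)%classic.
Proof.
move=> q1; rewrite qexpE //.
have := @cvg_derive1n_pseries _ _ j x (entire_qfactV q1).
by under [X in series X]eq_fun do rewrite mulrC.
Qed.

(** * Growth of linear recurrences *)

(** For j <= n, the left-hand side divided by j! and multiplied by delta^j is
    one of the terms of the binomial expansion of (x + delta)^n.  So the
    polynomial factor produced by differentiation costs only an arbitrarily
    small increase of x. *)
Lemma ffact_expr_le (R : realFieldType) (x delta : R) (n j : nat) :
  0 <= x -> 0 < delta ->
  (n ^_ j)%:R * x ^+ (n - j) <= j`!%:R / delta ^+ j * (x + delta) ^+ n.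
Proof.
move=> x0 delta0.
have rhs0 : 0 <= j`!%:R / delta ^+ j * (x + delta) ^+ n.
  by rewrite !mulr_ge0 ?invr_ge0 ?exprn_ge0 // ?addr_ge0 // ltW.
have [lenj|ltnj] := leqP j n; last by rewrite ffact_small // mul0r.
have term : x ^+ (n - j) * delta ^+ j *+ 'C(n, j) <= (x + delta) ^+ n.
  rewrite exprDn (bigD1 (Ordinal (lenj : (j < n.+1)%N))) //= lerDl.
  rewrite sumr_ge0 // => i _.
  by rewrite mulrn_wge0 // mulr_ge0 // exprn_ge0 // ltW.
rewrite -bin_ffact natrM [leRHS]mulrAC ler_pdivlMr ?exprn_gt0 //.
rewrite [leLHS](_ : _ = j`!%:R * (x ^+ (n - j) * delta ^+ j *+ 'C(n, j))).
  by rewrite ler_wpM2l.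
by rewrite -mulr_natl; ring.
Qed.

Lemma normc_ge0 (R : rcfType) (z : R[i]) : 0 <= normc z.
Proof. by case: z => a b; apply: sqrtr_ge0. Qed.

Lemma normc_sum (R : rcfType) (I : finType) (F : I -> R[i]) :
  normc (\sum_i F i) <= \sum_i normc (F i).
Proof.
elim/big_rec2: _ => [|i y x _ le_xy]; first by rewrite normc0.
by apply: le_trans (le_normcD _ _) _; rewrite lerD2l.
Qed.

Lemma normcX (R : rcfType) (z : R[i]) n : normc (z ^+ n) = normc z ^+ n.
Proof. by elim: n => [|n IHn]; rewrite ?normc1 // !exprS normcM IHn. Qed.

Lemma normc_nat (R : rcfType) n : normc (n%:R : R[i]) = n%:R.
Proof. by rewrite (normcMn (1 : Rcomplex R)) normc1. Qed.

Lemma normc_real (R : rcfType) (x : R) : normc (x%:C%C) = `|x|.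
Proof. by rewrite /normc /= expr0n /= addr0 sqrtr_sqr. Qed.

(** The values on the monomials X^n of the linear form
    f |-> sum_(k,j) c_(k,j) f^(j)(alpha_k), that is, a linear recurrent
    sequence with roots the alpha_k. *)
Definition exp_poly_seq (K : nzRingType) (m M : nat) (alpha : 'I_m -> K)
    (c : 'I_m -> 'I_M -> K) (n : nat) : K :=
  \sum_k \sum_j c k j * (('X^n)^`(j)).[alpha k].

Lemma rmorph_exp_poly_seq (K L : nzRingType) (f : {rmorphism K -> L})
    (m M : nat)
    (alpha : 'I_m -> K) (c : 'I_m -> 'I_M -> K) (n : nat) :
  f (exp_poly_seq alpha c n) =
  exp_poly_seq (fun k => f (alpha k)) (fun k j => f (c k j)) n.
Proof.
rewrite rmorph_sum; apply: eq_bigr => k _; rewrite rmorph_sum.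
apply: eq_bigr => j _.
by rewrite rmorphM !derivnXn !hornerMn !hornerXn rmorphMn rmorphXn.
Qed.

Lemma exp_poly_seq_growth (R : realType) (m M : nat) (alpha : 'I_m -> R[i])
    (c : 'I_m -> 'I_M -> R[i]) (B t : R) :
  0 < B -> 1 < t -> (forall k, normc (alpha k) <= B) ->
  exists2 C, 0 <= C &
    forall n, normc (exp_poly_seq alpha c n) <= C * (B * t) ^+ n.
Proof.
move=> B0 t1 leB; pose delta := B * (t - 1).
have delta0 : 0 < delta by rewrite mulr_gt0 // subr_gt0.
have Bt : B + delta = B * t by rewrite /delta; ring.
exists (\sum_k \sum_j normc (c k j) * (j`!%:R / delta ^+ j)).
  do 2!(apply: sumr_ge0 => ? _).
  by rewrite !mulr_ge0 ?normc_ge0 ?invr_ge0 // exprn_ge0 // ltW.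
move=> n; rewrite mulr_suml; apply: le_trans (normc_sum _) _.
apply: ler_sum => k _; rewrite mulr_suml; apply: le_trans (normc_sum _) _.
apply: ler_sum => j _; rewrite normcM -mulrA ler_wpM2l ?normc_ge0 //.
rewrite derivnXn hornerMn hornerXn -mulr_natl normcM normc_nat normcX.
apply: (le_trans (ffact_expr_le _ _ (normc_ge0 _) delta0)).
rewrite ler_wpM2l ?divr_ge0 ?exprn_ge0 ?(ltW delta0) //.
rewrite -Bt lerXn2r ?nnegrE ?addr_ge0 ?normc_ge0 ?(ltW delta0) ?(ltW B0) //.
by rewrite lerD2r.
Qed.

(** Take for t the root of order k + 1 of Q / X: t^k is smaller than t^(k+1),
    which equals Q / X. *)
Lemma slack_exists (R : realType) (X Q : R) (k : nat) :
  0 < X -> X < Q -> exists2 t : R, 1 < t & X * t ^+ k < Q.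
Proof.
move=> X0 XQ; pose Y := Q / X.
have Y1 : 1 < Y by rewrite ltr_pdivlMr // mul1r.
pose t := expR (ln Y / k.+1%:R).
have t1 : 1 < t by rewrite expR_gt1 divr_gt0 // ln_gt0.
exists t => //.
have tk : t ^+ k.+1 = Y.
  rewrite -expRM_natl -mulr_natl mulrC divfK ?pnatr_eq0 // lnK // posrE.
  exact: lt_trans Y1.
have <- : X * Y = Q by rewrite /Y mulrC divfK // gt_eqF.
by rewrite ltr_pM2l // -tk ltr_eXn2l.
Qed.

(** * The partial sums multiplied by a q-factorial *)

(** This is [N]_q! (c0 + sum_(n <= N) u_n / [n]_q!), see [scaled_sumE].  Being
    polynomial in the data, the recursive form makes sense in every ring,
    commutes with ring morphisms and preserves integrality. *)
Fixpoint scaled_sum (K : nzRingType) (q c0 : K) (u : nat -> K) (N : nat) : K :=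
  if N is N'.+1 then (q ^+ N - 1) * scaled_sum q c0 u N' + u N else c0 + u 0%N.

Lemma rmorph_scaled_sum (K L : nzRingType) (f : {rmorphism K -> L})
    (q c0 : K) (u : nat -> K) (N : nat) :
  f (scaled_sum q c0 u N) = scaled_sum (f q) (f c0) (fun n => f (u n)) N.
Proof.
elim: N => [|N IHN] /=; first by rewrite rmorphD.
by rewrite rmorphD rmorphM rmorphB rmorphXn rmorph1 IHN.
Qed.

Lemma scaled_sumE (R : realType) (q c0 : R) (u : nat -> R) (N : nat) :
  1 < `|q| ->
  scaled_sum q c0 u N = qfact q N * (c0 + \sum_(0 <= n < N.+1) u n / qfact q n).
Proof.
move=> q1; elim: N => [|N IHN] /=.
  by rewrite big_nat1 /qfact big_geq // divr1 mul1r.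
rewrite IHN (big_nat_recr N.+1) //= addrA [RHS]mulrDr.
by rewrite [X in _ = _ + X]mulrC divfK ?qfact_neq0 // qfactS mulrA.
Qed.

(** Reading the recurrence backwards,
    A_N = (A_(N+1) - u_(N+1)) / (q^(N+1) - 1).  As A_N / [N]_q! tends to 0, A_N
    is the limit in p of [N]_q! times minus the sum of the u_n / [n]_q! for
    N < n <= N + p, and these finite sums obey the same backward recurrence,
    starting from 0 for p = 0: an induction on p bounds them uniformly. *)
Lemma backward_decay (R : realType) (q c0 a C : R) (u : nat -> R) :
  1 < `|q| -> 0 < a -> 0 <= C -> (forall n, `|u n| <= C * a ^+ n) ->
  (scaled_sum q c0 u N / qfact q N @[N --> \oo] --> (0 : R))%classic ->
  exists2 K, 0 <= K &
    \forall N \near \oo%classic, `|scaled_sum q c0 u N| <= K * (a / `|q|) ^+ N.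
Proof.
move=> q1 a0 C0 leu sum0; set A := scaled_sum q c0 u.
have q0 : 0 < `|q| := lt_trans ltr01 q1.
have q10 : 0 < `|q| - 1 by rewrite subr_gt0.
pose r := a / `|q|; have r0 : 0 < r by rewrite divr_gt0.
pose K := 2 * C * a / (`|q| - 1).
have K0 : 0 <= K by rewrite divr_ge0 ?mulr_ge0 // ltW.
(* From N1 on, the term in A_(N+1) accounts for at most half of the bound on
   A_N; the constant K is such that u_(N+1) accounts for the other half. *)
have [N1 _ leN1] := near_expr_ge (2 * r / (`|q| - 1)) q1.
have trunc p N : (N1 <= N)%N ->
    `|A N - qfact q N / qfact q (N + p) * A (N + p)%N| <= K * r ^+ N.
  elim: p N => [|p IHp] N leN.
    rewrite addn0 divff ?qfact_neq0 // mul1r subrr normr0.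
    by rewrite mulr_ge0 // exprn_ge0 // ltW.
  rewrite addnS -addSn; set B := A (N.+1 + p)%N; set w := qfact q (N.+1 + p).
  have -> : A N - qfact q N / w * B =
      (A N.+1 - qfact q N.+1 / w * B - u N.+1) / (q ^+ N.+1 - 1).
    rewrite /A /= -/A qfactS; field.
    by rewrite qfact_neq0 // qint_neq0.
  rewrite normrM normfV ler_pdivrMr ?normr_gt0 ?qint_neq0 //.
  have uN := leu N.+1; have IHN := IHp N.+1 (leqW leN).
  apply: le_trans (ler_normB _ _) _; apply: le_trans (lerD IHN uN) _.
  have qN := normr_qint_ge N q1.
  apply: (@le_trans _ _ (K * r ^+ N * (`|q| ^+ N * (`|q| - 1)))); last first.
    by rewrite ler_wpM2l // mulr_ge0 // exprn_ge0 // ltW.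
  have Ca : C * a ^+ N.+1 = K / 2 * (`|q| - 1) * (r ^+ N * `|q| ^+ N).
    rewrite -exprMn /r divfK ?gt_eqF // exprS /K; field.
    by rewrite gt_eqF.
  have rq : r <= `|q| ^+ N * (`|q| - 1) / 2.
    have := leN1 N leN; rewrite ler_pdivrMr // => ?; lra.
  have : K * r ^+ N * r <= K * r ^+ N * (`|q| ^+ N * (`|q| - 1) / 2).
    by rewrite ler_wpM2l // mulr_ge0 // exprn_ge0 // ltW.
  rewrite exprS Ca; lra.
exists K => //; exists N1 => // N leN.
have cvgN : (A N - qfact q N * (A (p + N)%N / qfact q (p + N)) @[p --> \oo]
    --> A N - qfact q N * 0)%classic.
  apply: cvgB; first exact: cvg_cst.
  apply: cvgM; first exact: cvg_cst.
  by rewrite (cvg_shiftn N (fun n => A n / qfact q n)).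
rewrite mulr0 subr0 in cvgN.
have cvgnN := cvg_norm cvgN _.
rewrite -(cvg_lim (@norm_hausdorff _ _) (cvgnN _)).
apply: limr_le; first by apply/cvg_ex; exists `|A N|; exact: cvgnN.
apply: nearW => p; have := trunc p N leN.
by rewrite addnC mulrAC mulrA.
Qed.

(** Since s^N tends to 0, the factor 1 + s^N is eventually below some gamma
    smaller than beta, and a bound K beta^N then propagates from N to N + 1 once
    K (beta - gamma) >= C beta. *)
Lemma forward_growth (R : realType) (s beta C : R) (x : nat -> R) :
  0 <= s -> s < 1 -> 1 < beta -> 0 <= C -> (forall N, 0 <= x N) ->
  (forall N, x N.+1 <= (1 + s ^+ N.+1) * x N + C * beta ^+ N.+1) ->
  exists2 K, 0 <= K & \forall N \near \oo%classic, x N <= K * beta ^+ N.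
Proof.
move=> s0 s1 beta1 C0 x0 xS; pose gamma := (1 + beta) / 2.
have gamma1 : 0 < gamma - 1 by rewrite /gamma; lra.
have gammab : 0 < beta - gamma by rewrite /gamma; lra.
have [N1 _ leN1] : \forall N \near \oo%classic, s ^+ N <= gamma - 1.
  by apply: near_expr_le => //; rewrite ger0_norm.
pose K := x N1 + C * beta / (beta - gamma).
have beta0 : 0 <= beta by lra.
have K0 : 0 <= K by rewrite addr_ge0 // divr_ge0 ?mulr_ge0 // ltW.
exists K => //; exists N1 => // N /subnKC<-; elim: (N - N1)%N => [|p IHp].
  rewrite addn0; apply: (@le_trans _ _ (K * 1)).
    by rewrite mulr1 lerDl divr_ge0 ?mulr_ge0 // ltW.
  by rewrite ler_wpM2l // exprn_ege1 // ltW.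
rewrite addnS; apply: le_trans (xS _) _.
have sN : s ^+ (N1 + p).+1 <= gamma - 1.
  by apply: leN1; rewrite /= -addnS leq_addr.
apply: (@le_trans _ _
  (gamma * (K * beta ^+ (N1 + p)) + C * beta ^+ (N1 + p).+1)).
  by rewrite lerD2r ler_pM ?addr_ge0 ?exprn_ge0 //; lra.
have -> : C * beta ^+ (N1 + p).+1 = C * beta * beta ^+ (N1 + p).
  by rewrite exprS mulrA.
have leK : gamma * K + C * beta <= K * beta.
  rewrite -lerBrDl -[K * beta - _]/(K * beta - gamma * K).
  rewrite (_ : K * beta - gamma * K = K * (beta - gamma)); last by ring.
  by rewrite -ler_pdivrMr // lerDr.
by rewrite exprS mulrA mulrA -mulrDl ler_wpM2r ?exprn_ge0.
Qed.

Lemma scaled_sum_integral (K : fieldType) (q c0 : K) (u : nat -> K) :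
  Zintegral q -> Zintegral c0 ->
  (forall n, Zintegral (u n)) ->
  forall N, Zintegral (scaled_sum q c0 u N).
Proof.
move=> intq intc0 intu; elim=> [|N IHN]; first exact: integral_add.
apply: integral_add => //; apply: integral_mul => //.
apply: integral_sub (integral1 _).
by elim: N.+1 => [|n IHn]; rewrite ?exprS;
  [exact: integral1 | exact: integral_mul].
Qed.

Lemma exp_poly_seq_integral (K : fieldType) (m M : nat) (alpha : 'I_m -> K)
    (c : 'I_m -> 'I_M -> K) :
  (forall k, Zintegral (alpha k)) ->
  (forall k j, Zintegral (c k j)) ->
  forall n, Zintegral (exp_poly_seq alpha c n).
Proof.
move=> inta intc n.
have int_sum I r (F : I -> K) : (forall i, Zintegral (F i)) ->
    Zintegral (\sum_(i <- r) F i).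
  move=> intF; apply: big_ind => // [|x y]; first exact: mxpoly.integral0.
  exact: integral_add.
apply: (int_sum) => k; apply: (int_sum) => j; apply: integral_mul => //.
rewrite derivnXn hornerMn hornerXn -mulr_natl.
apply: integral_mul; first exact: integral_nat.
by elim: (n - j)%N => [|i IHi]; rewrite ?exprS;
  [exact: integral1 | exact: integral_mul].
Qed.

(** Inserting the power series of the values E_q^(j)(alpha_k) into the linear
    relation and collecting the terms of index n. *)
Lemma qexp_values_dependent_cvg (R : realType) (q : R) (m M : nat)
    (alpha : 'I_m -> Qadjoin q) (c : option ('I_m * 'I_M.+1) -> Qadjoin q) :
  1 < `|q| ->
  \sum_i (c i : R) * qexp_values alpha i = 0 ->
  (scaled_sum q (c None : R)
     (exp_poly_seq (fun k => alpha k : R) (fun k j => c (Some (k, j)) : R)) N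
   / qfact q N @[N --> \oo] --> (0 : R))%classic.
Proof.
move=> q1 sum0; set u := exp_poly_seq _ _.
have cvgS : (\sum_k \sum_j (c (Some (k, j)) : R) *
     series (fun n => (('X^n)^`(j)).[(alpha k : R)] / qfact q n) N
     @[N --> \oo] -->
     \sum_k \sum_j (c (Some (k, j)) : R) *
       derive1n j (qexp q) (alpha k : R))%classic.
  apply: cvg_big => [|k _]; first exact: add_continuous.
  apply: cvg_big => [|j _]; first exact: add_continuous.
  apply: cvgM; first exact: cvg_cst.
  exact: cvg_derive1n_qexp.
have cvgT : ((c None : R) + \sum_(0 <= n < N.+1) u n / qfact q n
    @[N --> \oo] -->
    \sum_i (c i : R) * qexp_values alpha i)%classic.
  rewrite (bigD1 None) //= mulr1.
  rewrite (_ : \sum_(i | _) _ = \sum_k \sum_j (c (Some (k, j)) : R) *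
    derive1n j (qexp q) (alpha k : R)); last first.
    rewrite pair_bigA /= (reindex_omap Some id) /=; last by case.
    by apply: eq_big => [[k j]|[k j] _] //=; rewrite eqxx.
  apply: cvgD; first exact: cvg_cst.
  have := cvgS; rewrite -(cvg_shiftS); apply: cvg_trans.
  apply: near_eq_cvg; near=> N.
  under [RHS]eq_bigr do rewrite /u /exp_poly_seq mulr_suml.
  rewrite [RHS]exchange_big; apply: eq_bigr => k _.
  under [RHS]eq_bigr do rewrite mulr_suml.
  rewrite [RHS]exchange_big; apply: eq_bigr => j _.
  rewrite /series /= mulr_sumr; apply: eq_bigr => i _.
  by rewrite mulrA.
rewrite sum0 in cvgT; apply: cvg_trans cvgT; apply: near_eq_cvg; near=> N.
by rewrite scaled_sumE // mulrAC mulfV ?qfact_neq0 // mul1r.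
Unshelve. all: by end_near.
Qed.

(** * The norm of the scaled partial sums *)

Lemma eventually_prod_lt1 (R : realType) (n : nat) (x : 'I_n -> nat -> R)
    (K r : 'I_n -> R) :
  (forall l N, 0 <= x l N) -> (forall l, 0 <= K l) -> (forall l, 0 <= r l) ->
  \prod_l r l < 1 ->
  (forall l, \forall N \near \oo%classic, x l N <= K l * r l ^+ N) ->
  \forall N \near \oo%classic, \prod_l x l N < 1.
Proof.
move=> x0 K0 r0 r1 lex.
have prodK0 : 0 <= \prod_l K l by apply: prodr_ge0.
have e0 : 0 < (2 * (\prod_l K l + 1))^-1.
  by rewrite invr_gt0 mulr_gt0 // ltr_wpDl.
have small : \forall N \near \oo%classic,
    (\prod_l r l) ^+ N <= (2 * (\prod_l K l + 1))^-1.
  by apply: near_expr_le => //; rewrite ger0_norm // prodr_ge0.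
have all_le : \forall N \near \oo%classic, forall l, x l N <= K l * r l ^+ N.
  exact: filter_forall.
near=> N.
apply: (@le_lt_trans _ _ (\prod_l (K l * r l ^+ N))).
  apply: ler_prod => l _; rewrite x0 /=; move: l; near: N; exact: all_le.
rewrite big_split /= prodrXl.
apply: (@le_lt_trans _ _ (\prod_l K l * (2 * (\prod_l K l + 1))^-1)).
  by rewrite ler_wpM2l //; near: N; exact: small.
rewrite ltr_pdivrMr ?mul1r ?mulr_gt0 // ?ltr_wpDl //; lra.
Unshelve. all: by end_near.
Qed.

Theorem corollary1p1 (R : realType) (q : R)
  (hq : PV_number q \/ PV_number (- q))
  (n : nat) (hn : Qadjoin_degree q n.+1)
  (sigma : 'I_n.+1 -> {rmorphism Qadjoin q -> R[i]})
  (hsigma : lists_embeddings sigma)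
  (m M : nat) (hm : (1 <= m)%N)
  (alpha : 'I_m -> Qadjoin q)
  (halpha0 : forall k, alpha k != 0)
  (halphaZ : forall k, algebraic_integer (alpha k : R))
  (hsize : (\big[Num.max/0]_(k < m) `|(alpha k : R)|) *
      \prod_(l < n.+1 | l != ord0)
        \big[Num.max/1]_(k < m) normc (sigma l (alpha k)) < `|q|)
  (hroot : forall k1 k2 : 'I_m, k1 != k2 ->
    forall N : nat, (0 < N)%N -> ~~ N.-unity_root (alpha k1 / alpha k2)) :
  Qadjoin_lin_indep q (@qexp_values R q m M alpha).
Proof.
pose Qv := Qinj q.
have [sigma0 sigma_inj _] := hsigma.
have q1 : 1 < `|q|.
  by case: hq => -[_ q1 _]; last rewrite -normrN;
    apply: lt_le_trans q1 (ler_norm _).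
have q0 : 0 < `|q| := lt_trans ltr01 q1.
have intq : algebraic_integer q.
  by case: hq => -[] // intNq _ _; rewrite -[q]opprK; apply: integral_opp.
have intgen : Zintegral (Qgen q).
  exact/(fmorph_integral Qv).
have alpha_inj : injective alpha.
  (* Equal alpha's have quotient 1, a root of unity of order 1. *)
  move=> k1 k2 eq_a; apply/eqP/negPn/negP => /hroot/(_ 1%N isT)/negP; apply.
  by rewrite eq_a divff //; apply/unity_rootP; rewrite expr1.
move=> c sumc0; have [d d0 intdc] := family_integral_denominator c intq.
pose c' i := d * c i.
suff c'0 : forall i, c' i = 0.
  by move=> i; apply/eqP; have /eqP := c'0 i; rewrite mulf_eq0 (negPf d0).
have sumc'0 : \sum_i (c' i : R) * qexp_values alpha i = 0.
  transitivity ((d : R) * \sum_i (c i : R) * qexp_values alpha i).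
    by rewrite mulr_sumr; apply: eq_bigr => i _; rewrite mulrA.
  by rewrite sumc0 mulr0.
pose cc k j := c' (Some (k, j)).
pose u := exp_poly_seq alpha cc.
pose A := scaled_sum (Qgen q) (c' None) u.
have intA N : Zintegral (A N).
  apply: scaled_sum_integral => // [|i]; first exact: intdc.
  apply: exp_poly_seq_integral => [k|k j]; last exact: intdc.
  exact/(fmorph_integral Qv)/halphaZ.
pose a : R := \big[Num.max/0]_(k < m) `|(alpha k : R)|.
pose b (l : 'I_n.+1) : R := \big[Num.max/1]_(k < m) normc (sigma l (alpha k)).
have a0 : 0 < a.
  pose k0 := Ordinal hm; apply: (@lt_le_trans _ _ `|(alpha k0 : R)|).
    by rewrite normr_gt0 (fmorph_eq0 Qv).
  exact: le_bigmax.
have b1 l : 1 <= b l by apply: bigmax_ge_id.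
have X0 : 0 < a * \prod_(l < n.+1 | l != ord0) b l.
  by rewrite mulr_gt0 // prodr_gt0 // => l _; apply: lt_le_trans (b1 l).
(* The growth estimates lose a factor t^N for each of the n + 1 embeddings,
   which the strict inequality of the hypothesis leaves room for. *)
have [t t1 slack] := slack_exists n.+1 X0 hsize.
pose r (l : 'I_n.+1) := if l == ord0 then a * t / `|q| else b l * t.
have t0 : 0 < t := lt_trans ltr01 t1.
have r0 l : 0 <= r l.
  rewrite /r; case: eqP => _; first by rewrite !mulr_ge0 ?invr_ge0 // ltW.
  by rewrite mulr_ge0 // ?(le_trans ler01) // ltW.
have prodr1 : \prod_l r l < 1.
  rewrite (bigD1 ord0) //= /r eqxx.
  under eq_bigr => l l0 do rewrite (negPf l0).
  rewrite big_split /= prodr_const.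
  rewrite mulrAC ltr_pdivrMr // mul1r mulrACA -exprS.
  apply: le_lt_trans slack; rewrite ler_wpM2l ?(ltW X0) //.
  by rewrite (cardC1 (ord0 : 'I_n.+1)) card_ord.
(* The inclusion is treated by the tail of the series, the other embeddings by
   the recurrence. *)
have boundA l : exists2 K, 0 <= K &
    \forall N \near \oo%classic, normc (sigma l (A N)) <= K * r l ^+ N.
  rewrite /r; have [->|l0] := eqVneq l ord0.
    have normE y : normc (sigma ord0 y) = `|Qv y| by rewrite sigma0 normc_real.
    have [|C C0 leu] := @exp_poly_seq_growth R m _
        (fun k => sigma ord0 (alpha k)) (fun k j => sigma ord0 (cc k j))
        a t a0 t1.
      by move=> k; rewrite normE; apply: le_bigmax.
    have [|N|K K0 leK] := @backward_decay R q (Qv (c' None)) (a * t) C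
        (fun i => Qv (u i)) q1 (mulr_gt0 a0 t0) C0.
    - by move=> i; rewrite -normE rmorph_exp_poly_seq.
    - have -> : (fun i => Qv (u i)) = exp_poly_seq (fun k => Qv (alpha k))
          (fun k j => Qv (cc k j)).
        by apply/funext => i; apply: rmorph_exp_poly_seq.
      exact: qexp_values_dependent_cvg.
    exists K => //; apply: filterS leK => N.
    by rewrite normE rmorph_scaled_sum.
  have [|C C0 leu] := @exp_poly_seq_growth R m _ (fun k => sigma l (alpha k))
        (fun k j => sigma l (cc k j)) (b l) t (lt_le_trans ltr01 (b1 l)) t1.
    by move=> k; apply: le_bigmax.
  have s1 := PV_embedding_lt1 hsigma hq l0.
  apply: (@forward_growth R (normc (sigma l (Qgen q))) (b l * t) C) => //.
  - exact: normc_ge0.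
  - by apply: lt_le_trans t1 _; rewrite ler_peMl // ltW.
  - by move=> N; apply: normc_ge0.
  move=> N; rewrite {1}/A /= rmorphD rmorphM rmorphB rmorphXn rmorph1.
  apply: le_trans (le_normcD _ _) _; rewrite normcM.
  apply: lerD; last by rewrite rmorph_exp_poly_seq.
  rewrite ler_wpM2r ?normc_ge0 //; apply: le_trans (le_normcD _ _) _.
  by rewrite normcN normc1 normcX addrC.
have /choice[K leA] l : exists K, 0 <= K /\
    \forall N \near \oo%classic, normc (sigma l (A N)) <= K * r l ^+ N.
  by have [K] := boundA l; exists K.
have [N0 _ zeroA] : \forall N \near \oo%classic, A N = 0.
  have := eventually_prod_lt1 _ _ r0 prodr1 (fun l => (leA l).2).
  move=> /(_ (fun _ _ => normc_ge0 _) (fun l => (leA l).1)).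
  apply: filterS => N ltA.
  apply/eqP/negPn/negP => A0.
  by have := norm_integral_ge1 hn sigma_inj (intA N) A0; rewrite leNgt ltA.
(* The recurrence expresses u_N through A_N and A_(N-1). *)
have zerou N : (N0.+1 <= N)%N -> u N = 0.
  case: N => // N leN; have := zeroA N.+1 (leqW leN).
  by rewrite /A /= -/A zeroA // mulr0 add0r.
have zerocc k j : cc k j = 0.
  apply: (fmorph_inj Qv); rewrite rmorph0.
  apply: (@confluent_Vandermonde R m M.+1 (fun k => Qv (alpha k)) _ _
    (fun k j => Qv (cc k j)) N0.+1).
  - by move=> k1 k2 eq_a; apply/alpha_inj/(fmorph_inj Qv).
  - by move=> i; rewrite fmorph_eq0.
  move=> N leN; rewrite -[LHS](rmorph_exp_poly_seq Qv alpha cc).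
  by rewrite [exp_poly_seq _ _ _]zerou ?rmorph0.
case=> [[k j]|]; first exact: zerocc.
apply: (fmorph_inj Qv); rewrite rmorph0 -[LHS]mulr1 -[RHS]sumc'0.
rewrite [RHS](bigD1 None) // [X in _ = _ + X]big1 ?addr0 // => -[[k j]|] // _.
by rewrite [c' _]zerocc mul0r.
Qed.
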